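(* Let $n\geq 3$, let $P\in\mathbb{C}[x_1,\ldots,x_n]$ be a homogeneous polynomial of degree $e$, and let $\omega=dP$ (a homogeneous one-form of degree $e$ on $\mathbb{C}^n$). Suppose that the codimension of the singular locus of $dP$ is $\geq 3$. Then all first order deformations of $\omega$ by homogeneous one-forms of the same degree $e$ are exact of the type $$\omega_\varepsilon=d(P+\varepsilon Q),$$ where $Q$ is a homogeneous polynomial of degree $e$.
   Context: A polynomial one-form $\eta=\sum_{i=1}^n H_i\,dx_i$ on $\mathbb{C}^n$ is called homogeneous of degree $e$ if all $H_i$ are homogeneous polynomials of degree $e-1$. The singular locus of $dP$ is the common zero set in $\mathbb{C}^n$ of its coefficients $\partial P/\partial x_i$. A first order deformation of an integrable one-form $\omega$ (i.e. $\omega\wedge d\omega=0$) by homogeneous one-forms of the same degree $e$ is $\omega_\varepsilon=\omega+\varepsilon\eta$, where $\eta$ is a polynomial one-form homogeneous of degree $e$, $\varepsilon^2=0$, and $\omega_\varepsilon\wedge d\omega_\varepsilon=0$; equivalently $\omega\wedge d\eta+d\omega\wedge\eta=0$. *)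

(* Defs.v *)
From HB Require Import structures.
From mathcomp Require Import all_boot all_order all_algebra.
From mathcomp Require Export complex mpoly classical_sets reals.

Set Implicit Arguments.
Unset Strict Implicit.
Unset Printing Implicit Defensive.

Import GRing.Theory.

Local Open Scope ring_scope.
Local Open Scope classical_set_scope.

(* The exterior algebra of polynomial differential forms on C^n: the value of
   a form at A = {i_1 < ... < i_p} is its coefficient on
   dx_{i_1} /\ ... /\ dx_{i_p}. *)
Definition dform (C : comNzRingType) (n : nat) : zmodType :=
  {ffun {set 'I_n} -> {mpoly C[n]}}.

(* dx_A /\ dx_B = (-1)^(wedge_inv A B) dx_(A :|: B) when A and B are disjoint *)
Definition wedge_inv (n : nat) (A B : {set 'I_n}) : nat :=
  #|[set p : 'I_n * 'I_n | [&& p.1 \in A, p.2 \in B & (p.2 < p.1)%N]]%SET|.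

Definition wedge (C : comNzRingType) (n : nat) (a b : dform C n) : dform C n :=
  [ffun S : {set 'I_n} => \sum_(A : {set 'I_n} | A \subset S)
     (-1) ^+ wedge_inv A (S :\: A)%SET * (a A * b (S :\: A)%SET)].

(* d (f dx_B) = \sum_j (df/dx_j) dx_j /\ dx_B *)
Definition extd (C : comNzRingType) (n : nat) (a : dform C n) : dform C n :=
  [ffun S : {set 'I_n} => \sum_(j in S)
     (-1) ^+ wedge_inv [set j]%SET (S :\ j)%SET * (a (S :\ j)%SET)^`M(j)].

Definition zeroform (C : comNzRingType) (n : nat) (f : {mpoly C[n]}) :
    dform C n :=
  [ffun S : {set 'I_n} => if S == finset.set0 then f else 0].

Definition oneform (C : comNzRingType) (n : nat) (H : 'I_n -> {mpoly C[n]}) :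
    dform C n :=
  [ffun S : {set 'I_n} => \sum_(i | S == [set i]%SET) H i].

(* Coefficients of degree e - 1; only the zero form is homogeneous of
   degree 0. *)
Definition homog_oneform (C : comNzRingType) (n e : nat) (eta : dform C n) :
    Prop :=
  exists H : 'I_n -> {mpoly C[n]}, eta = oneform H /\
    forall i, if e is d.+1 then H i \is d.-homog else H i = 0.

(* Forms with coefficients in C[eps], eps^2 = 0: the pair (a, b) stands for
   a + eps b. *)
Definition eps_wedge (C : comNzRingType) (n : nat)
    (a b : dform C n * dform C n) : dform C n * dform C n :=
  (wedge a.1 b.1, wedge a.1 b.2 + wedge a.2 b.1).

Definition eps_extd (C : comNzRingType) (n : nat)
    (a : dform C n * dform C n) : dform C n * dform C n :=
  (extd a.1, extd a.2).

Definition first_order_deformation (C : comNzRingType) (n e : nat)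
    (omega eta : dform C n) : Prop :=
  homog_oneform e eta /\
  eps_wedge (omega, eta) (eps_extd (omega, eta)) = 0.

Definition singular_locus (C : comNzRingType) (n : nat) (omega : dform C n) :
    set ('I_n -> C) :=
  [set x | forall i : 'I_n, (omega [set i]%SET).@[x] = 0].

Definition zariski_closed (C : comNzRingType) (n : nat)
    (Z : set ('I_n -> C)) : Prop :=
  exists F : set {mpoly C[n]}, Z = [set x | forall f, F f -> f.@[x] = 0].

Definition irreducible_closed (C : comNzRingType) (n : nat)
    (Z : set ('I_n -> C)) : Prop :=
  [/\ zariski_closed Z, Z !=set0 &
      forall A B : set ('I_n -> C), zariski_closed A -> zariski_closed B ->
        Z = A `|` B -> Z = A \/ Z = B].

(* For Z irreducible closed, codim(Z, C^n) is the supremum of the lengths m of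
   the chains Z = W_0 < W_1 < ... < W_m of irreducible closed subsets of C^n;
   codim X is the infimum of codim(Z, C^n) over the irreducible closed Z
   contained in X (so it is infinite for X empty). *)
Definition codim_irr_ge (C : comNzRingType) (n c : nat)
    (Z : set ('I_n -> C)) : Prop :=
  exists2 m : nat, (c <= m)%N & exists W : nat -> set ('I_n -> C),
    [/\ W 0 = Z,
        forall i, (i <= m)%N -> irreducible_closed (W i) &
        forall i, (i < m)%N -> W i `<` W i.+1].

Definition codim_ge (C : comNzRingType) (n c : nat)
    (X : set ('I_n -> C)) : Prop :=
  forall Z : set ('I_n -> C),
    irreducible_closed Z -> Z `<=` X -> codim_irr_ge c Z.

(* Main.v *)
(* Let P_l and H_l be the coefficients of dP and eta. The condition says
   dP /\ d eta = 0, where the coefficients of d eta are homogeneous of degree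
   e - 2, less than the degree e - 1 of the P_l. If the coefficient ideal
   contains a regular sequence of length 3, the Koszul complex of the P_l is
   exact at the 2-forms, so d eta = dP /\ rho, and by degree d eta = 0; then
   Q = e^-1 sum_j x_j H_j has dQ = eta by Euler's formula.
   The regular sequence is found on a generic 3-dimensional linear subspace L.
   Codimension at least 3 of the cone V of zeros of dP means that no projection
   of V to C^(n-2) is dominant: an irreducible closed subset of V, minimal among
   those with dominant projection, would start a chain of length 3, and the
   transcendence degree would exceed n. Hence for any two vectors there is a
   nonzero polynomial vanishing on V and invariant under translation by them;
   three successive choices of a vector outside such zero sets give L meeting V
   only at 0. On L the homogeneous Nullstellensatz puts powers of the three
   coordinates in the coefficient ideal. *)

Require Import Defs.
From mathcomp Require Import all_boot all_order all_algebra.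
From mathcomp Require Import boolp ring zify.

Import Order.TTheory GRing.Theory.

Local Open Scope ring_scope.

Set Implicit Arguments.
Unset Strict Implicit.
Unset Printing Implicit Defensive.

(** * Noetherianity of polynomial rings *)

(** Reduction modulo [B] isolates digit 0, and division by [B] shifts the remaining digits down. *)
Lemma base_digits_inj (B k : nat) (f g : nat -> nat) :
    (forall i, (f i < B)%N) -> (forall i, (g i < B)%N) ->
    (\sum_(i < k) f i * B ^ i = \sum_(i < k) g i * B ^ i)%N ->
  forall i, (i < k)%N -> f i = g i.
Proof.
elim: k f g => // k IHk f g ltfB ltgB.
have shiftE (h : nat -> nat) :
    (\sum_(i < k.+1) h i * B ^ i = (\sum_(i < k) h i.+1 * B ^ i) * B + h 0)%N.
  rewrite big_ord_recl expn0 muln1 addnC; congr (_ + _)%N.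
  by rewrite big_distrl /=; apply: eq_bigr => i _; rewrite expnSr mulnA.
rewrite !shiftE => eqfg.
have B_gt0 : (0 < B)%N by apply: leq_ltn_trans (ltfB 0%N).
have eq0 : f 0%N = g 0%N.
  by have := congr1 (modn^~ B) eqfg; rewrite /= !modnMDl !modn_small.
have eqS : (\sum_(i < k) f i.+1 * B ^ i = \sum_(i < k) g i.+1 * B ^ i)%N.
  by apply/eqP; rewrite -(eqn_pmul2r B_gt0) -(eqn_add2r (f 0%N)) eqfg eq0.
by case=> // i lti; apply: (IHk (fun i => f i.+1) (fun i => g i.+1)) => // j.
Qed.

(* Kronecker's substitution 'X_i := 'X ^ (B ^ i), with B larger than all the
   exponents of p, keeps the monomials of p apart. *)
Lemma mpoly_nonroot (F : closedFieldType) (n : nat) (p : {mpoly F[n]}) :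
  p != 0 -> exists v : 'I_n -> F, p.@[v] != 0.
Proof.
move=> p0; pose B := msize p.
pose w (m : 'X_{1..n}) := (\sum_(i < n) m i * B ^ i)%N.
pose q : {poly F} := \sum_(m <- msupp p) p@_m *: 'X^(w m).
have ltB m : m \in msupp p -> forall i, (m i < B)%N.
  move=> /msize_mdeg_lt ltm i; apply: leq_ltn_trans ltm.
  by rewrite mdegE (bigD1 i) //= leq_addr.
have w_inj : {in msupp p &, injective w}.
  move=> m m' /ltB ltm /ltB ltm' eqw; apply/mnmP => i.
  have B_gt0 : (0 < B)%N by apply: leq_ltn_trans (ltm i).
  pose f (u : 'X_{1..n}) j := if insub j is Some k then u k else 0%N.
  have fE (u : 'X_{1..n}) (j : 'I_n) : f u j = u j by rewrite /f valK.
  have ltf (u : 'X_{1..n}) : (forall k, u k < B)%N -> forall j, (f u j < B)%N.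
    by move=> ltu j; rewrite /f; case: insubP.
  rewrite -!fE; apply: (base_digits_inj (ltf _ ltm) (ltf _ ltm')) (ltn_ord i).
  by rewrite !(eq_bigr _ (fun j _ => congr1 (muln^~ _) (fE _ j))).
have q0 : q != 0.
  have mlp := mlead_supp p0; apply: contraNneq p0 => q0.
  have := congr1 (fun r : {poly F} => r`_(w (mlead p))) q0.
  rewrite coef0 coef_sum (bigD1_seq (mlead p)) ?msupp_uniq //=.
  rewrite coefZ coefXn eqxx mulr1 big_seq_cond big1 ?addr0 => [/eqP|m].
    by rewrite mleadc_eq0.
  move=> /andP[mp nem]; rewrite coefZ coefXn; case: eqP => [/w_inj eqm|_].
    by rewrite eqm ?eqxx // in nem.
  by rewrite mulr0.
have /closed_nonrootP[t] := q0; rewrite /root => qt.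
exists (fun i => t ^+ (B ^ i)); rewrite mevalE.
apply: contraNneq qt => <-; rewrite /q horner_sum; apply/eqP/eq_bigr => m _.
rewrite hornerZ hornerXn; congr (_ * _); rewrite /w expr_sum.
by apply: eq_bigr => i _; rewrite mulnC exprM.
Qed.

(** Iterate one choice: past each index, take a position where [g] is minimal on the whole tail. *)
Lemma nondecreasing_subsequence (g : nat -> nat) :
  exists phi : nat -> nat, (forall i, phi i < phi i.+1)%N /\
    forall i, (g (phi i) <= g (phi i.+1))%N.
Proof.
have min_from N : {i | (N <= i)%N & forall j, (N <= j)%N -> (g i <= g j)%N}.
  apply: cid2.
  have ex : exists v, `[< exists2 i, (N <= i)%N & g i = v >].
    by exists (g N); apply/asboolP; exists N.
  have [v /asboolP[i leNi giv] vmin] := ex_minnP ex.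
  exists i => // j leNj; rewrite giv; apply: vmin; apply/asboolP.
  by exists j.
pose h N := s2val (min_from N).
have le_h N : (N <= h N)%N by rewrite /h; case: (min_from N).
have h_min N j : (N <= j)%N -> (g (h N) <= g j)%N.
  by rewrite /h; case: (min_from N) => i /= _; apply.
pose a := fix a k := if k is k'.+1 then (h (a k')).+1 else 0%N.
exists (h \o a); split=> i /=; first exact: le_h.
apply: h_min; apply: leq_trans (le_h (a i)) _; apply: leq_trans (leqnSn _) _.
exact: le_h.
Qed.

(** Nondecreasing subsequences are extracted for one coordinate after another; the first two terms
    of the last one are comparable. *)
Lemma dickson (n : nat) (f : nat -> 'X_{1..n}) :
  exists i j, (i < j)%N /\ (f i <= f j)%MM.
Proof.
have [phi [phi_lt phi_le]] : exists phi : nat -> nat,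
    (forall i, phi i < phi i.+1)%N /\
    forall k : 'I_n, (k < n)%N -> forall i, (f (phi i) k <= f (phi i.+1) k)%N.
  suff: forall m, exists phi : nat -> nat, (forall i, phi i < phi i.+1)%N /\
      forall k : 'I_n, (k < m)%N -> forall i, (f (phi i) k <= f (phi i.+1) k)%N.
    exact.
  elim=> [|m [phi [phi_lt phi_le]]]; first by exists id; split=> // i; exact: ltnSn.
  have [ltmn|lenm] := ltnP m n; last first.
    by exists phi; split=> // k _; apply: phi_le; apply: leq_trans (ltn_ord k) lenm.
  have [psi [psi_lt psi_le]] :=
    nondecreasing_subsequence (fun i => f (phi i) (Ordinal ltmn)).
  have homo_phi : {homo phi : i j / (i < j)%N}.
    exact: (homo_ltn ltn_trans phi_lt).
  exists (phi \o psi); split=> [i|k]; first exact: homo_phi.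
  rewrite ltnS leq_eqVlt => /orP[/eqP eqkm|ltkm] i /=.
    by have -> : k = Ordinal ltmn by apply/val_inj.
  exact: (homo_leq (fun _ => leqnn _) leq_trans (phi_le _ ltkm) (ltnW (psi_lt i))).
exists (phi 0%N), (phi 1%N); split=> //; apply/mnm_lepP => k; exact: phi_le.
Qed.

Definition mideal (R : comNzRingType) (n : nat) (I : set {mpoly R[n]}) : Prop :=
  [/\ I 0, forall a b, I a -> I b -> I (a + b) & forall a b, I b -> I (a * b)].

(* Along a strictly increasing sequence of ideals choose f_i, new at step i,
   with the smallest possible leading monomial; if that of f_i divides that of
   a later f_j, then reducing f_j modulo f_i contradicts minimality. *)
Lemma mideal_maximal (F : fieldType) (n : nat) (A : set (set {mpoly F[n]})) :
    (exists I, A I) -> (forall I, A I -> mideal I) ->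
  exists2 I, A I & forall J, A J -> (I `<=` J)%classic -> (J `<=` I)%classic.
Proof.
move=> [I0 AI0] Aid; apply: contrapT => nomax.
have step (I : {I | A I}) : {J : {J | A J} |
    (sval I `<=` sval J)%classic /\ ~ (sval J `<=` sval I)%classic}.
  apply: cid; apply: contrapT => noJ; apply: nomax; exists (sval I).
    exact: svalP I.
  move=> J AJ leIJ; apply: contrapT => nleJI.
  by apply: noJ; exists (exist _ J AJ).
have [G [_ GS]] := dependent_choice step (exist _ I0 AI0).
pose new i f := sval (G i.+1) f /\ ~ sval (G i) f.
have choose i : {f | new i f & forall g, new i g -> (mlead f <= mlead g)%O}.
  apply: cid2.
  have [_ /existsNP[f0 /not_implyP Gf0]] := GS i.
  move: {2}(mlead f0) (erefl (mlead f0)) => m.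
  elim/(well_founded_ind (@ltom_wf n)): m f0 Gf0 => m IHm f Gf eqm.
  have [[g [Gg ltgf]]|fmin] := pselect (exists g, new i g /\ (mlead g < mlead f)%O).
    by apply: (IHm (mlead g) _ g Gg) => //; rewrite -eqm.
  exists f => // g Gg; rewrite leNgt; apply/negP => ltgf; apply: fmin.
  by exists g.
pose f i := s2val (choose i).
have f_new i : new i (f i) by rewrite /f; case: (choose i).
have f_min i g : new i g -> (mlead (f i) <= mlead g)%O.
  by rewrite /f; case: (choose i) => h /= _; apply.
have Gid i : mideal (sval (G i)) := Aid _ (svalP (G i)).
have f0 i : f i != 0.
  have [G0 _ _] := Gid i; case: (f_new i) => _ nGf.
  by apply/eqP => fi0; apply: nGf; rewrite fi0.
have [i [j [ltij lefij]]] := dickson (fun k => mlead (f k)).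
have leG k l : (k <= l)%N -> (sval (G k) `<=` sval (G l))%classic.
  move=> /subnK <-; elim: (l - k)%N => // d IHd x /IHd.
  by rewrite addSn; case: (GS (d + k)%N) => + _; apply.
(* [h] is the multiple of [f i] with the leading term of [f j]. It lies in [G j] because [i < j], so
   [f j - h] is still new at step [j], while its leading term has been cancelled. *)
pose c := (f j)@_(mlead (f j)) / (f i)@_(mlead (f i)).
pose h := c *: 'X_[mlead (f j) - mlead (f i)] * f i.
have Gjh : sval (G j) h.
  by have [_ _ GM] := Gid j; apply/GM/(leG _ _ ltij); case: (f_new i).
have c0 : c != 0 by rewrite mulf_neq0 ?invr_eq0 ?mleadc_eq0.
have mX0 : 'X_[mlead (f j) - mlead (f i)] != 0 :> {mpoly F[n]}.
  by rewrite -mleadc_eq0 mleadXm mcoeffX eqxx oner_eq0.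
have mlh : mlead h = mlead (f j).
  by rewrite /h -scalerAl mleadZ // mleadM // mleadXm submK.
have mch : h@_(mlead h) = (f j)@_(mlead (f j)).
  rewrite /h -scalerAl mleadZ // mcoeffZ mleadM // mleadcM mleadXm mcoeffX eqxx mul1r.
  by rewrite divfK // mleadc_eq0.
have new_r : new j (f j - h).
  have [G0 GD GM] := Gid j; have [_ GD' GM'] := Gid j.+1; case: (f_new j) => Gf nGf.
  split.
    by apply: GD' => //; rewrite -mulN1r; apply/GM'/(leG _ _ (leqnSn j)).
  move=> Gr; apply: nGf; have -> : f j = f j - h + h by rewrite subrK.
  exact: GD.
have r0 : f j - h != 0.
  have [G0 _ _] := Gid j; case: new_r => _ nGr.
  by apply/eqP => r0; apply: nGr; rewrite r0.
have /f_min lejr := new_r.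
have : (mlead (f j - h) <= mlead (f j))%O.
  by apply: le_trans (mleadB_le _ _) _; rewrite mlh joinxx.
move=> lerj; have eqr : mlead (f j - h) = mlead (f j) by apply/le_anti/andP.
move: r0; rewrite -mleadc_eq0 eqr mcoeffB -{2}mlh mch subrr eqxx //.
Qed.

(** * Chains of irreducible closed sets *)

Section ZariskiClosed.
Local Open Scope classical_set_scope.

Context (F : fieldType) (n : nat).
Implicit Types (Z W : set ('I_n -> F)) (f g : {mpoly F[n]}).

Definition vanish Z : set {mpoly F[n]} := [set f | forall x, Z x -> f.@[x] = 0].

Lemma vanish_mideal Z : mideal (vanish Z).
Proof.
split=> [x _|a b a0 b0 x Zx|a b b0 x Zx]; first by rewrite meval0.
  by rewrite mevalD a0 // b0 // addr0.
by rewrite mevalM b0 // mulr0.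
Qed.

Lemma vanish_anti Z W : zariski_closed Z -> vanish Z `<=` vanish W -> W `<=` Z.
Proof.
move=> [S ->] le x Wx f Sf /=; apply: (le f) => // y; exact.
Qed.

Lemma zariski_closedI_zero Z f :
  zariski_closed Z -> zariski_closed (Z `&` [set x | f.@[x] = 0]).
Proof.
move=> [S ->]; exists (S `|` [set f]); apply/seteqP; split=> x /=.
  by move=> [S0 f0] g [/S0//|->].
by move=> S0; split=> [g Sg|]; apply: S0; [left|right].
Qed.

(** [Z] is the union of its intersections with the zero sets of [f] and [g], so one of them is all
    of [Z]. *)
Lemma vanish_prime Z f g : irreducible_closed Z ->
  vanish Z (f * g) -> vanish Z f \/ vanish Z g.
Proof.
move=> [clZ _ irrZ] Zfg.
have [|Zf|Zg] := irrZ _ _ (zariski_closedI_zero f clZ) (zariski_closedI_zero g clZ).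
- apply/seteqP; split=> x /=; last by case=> -[].
  move=> Zx; have /eqP := Zfg x Zx; rewrite mevalM mulf_eq0.
  by move=> /orP[] /eqP; [left|right].
- by left=> x; rewrite Zf => -[].
- by right=> x; rewrite Zg => -[].
Qed.

(** Zariski density of the image of [Z] under the map with components [y], in the form of algebraic
    independence of these components modulo [vanish Z]. *)
Definition dominant (m : nat) (y : m.-tuple {mpoly F[n]}) Z : Prop :=
  forall q : {mpoly F[m]}, vanish Z (q \mPo y) -> q = 0.

(** Take [W] with [vanish W] maximal among the closed dominant subsets of [Z]. If [W] is a union of
    two closed sets and neither is dominant, the product of a relation on each is a relation on
    [W]. *)
Lemma dominant_irreducible (m : nat) (y : m.-tuple {mpoly F[n]}) Z :
    zariski_closed Z -> dominant y Z ->
  exists W, [/\ irreducible_closed W, W `<=` Z & dominant y W].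
Proof.
move=> clZ domZ.
pose A := [set vanish W | W in [set W | [/\ zariski_closed W, W `<=` Z & dominant y W]]].
have [||_ [W [clW leWZ domW] <-] maxW] := @mideal_maximal F n A.
- by exists (vanish Z); exists Z => //=; split.
- by move=> _ [W _ <-]; apply: vanish_mideal.
have closed_dominant X : zariski_closed X -> X `<=` W -> dominant y X -> W = X.
  move=> clX leXW domX; apply/seteqP; split=> //.
  apply: vanish_anti => //; apply: maxW.
    by exists X => //; split=> // x /leXW /leWZ.
  by move=> f Wf x /leXW; apply: Wf.
exists W; split=> //; split=> //.
  apply: contrapT => W0; suff /domW/eqP : vanish W (1 \mPo y) by rewrite oner_eq0.
  by move=> x Wx; case: W0; exists x.
move=> X Y clX clY WXY.
have leXW : X `<=` W by rewrite WXY => x; left.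
have leYW : Y `<=` W by rewrite WXY => x; right.
have [domX|] := pselect (dominant y X); first by left; apply: closed_dominant.
have [domY _|] := pselect (dominant y Y); first by right; apply: closed_dominant.
move=> /existsNP[p /not_implyP[Yp /eqP p0]] /existsNP[q /not_implyP[Xq /eqP q0]].
suff /eqP : p * q = 0 by rewrite mulf_eq0 (negPf p0) (negPf q0).
apply: domW => x; rewrite WXY rmorphM mevalM => -[/Xq ->|/Yp ->].
  by rewrite mulr0.
by rewrite mul0r.
Qed.

Definition linindep (S : finType) (b : S -> {mpoly F[n]}) Z : Prop :=
  forall c : S -> F, vanish Z (\sum_s c s *: b s) -> forall s, c s = 0.

(** On [Z] only the terms with [f ^+ 0] survive, so their coefficients are 0. What remains is a
    multiple of [f], and [f] cancels because [vanish W] is prime and does not contain it. *)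
Lemma linindep_powers (S : finType) (b : S -> {mpoly F[n]}) Z W f (D : nat) :
    irreducible_closed W -> Z `<=` W -> vanish Z f -> ~ vanish W f ->
    linindep b Z ->
  linindep (fun s : S * 'I_D => b s.1 * f ^+ s.2) W.
Proof.
move=> irrW leZW Zf nWf indb c Wc.
(* Indexing the exponents by [nat] lets the induction on [D] shift them. *)
suff indW : forall (c : nat -> S -> F),
    vanish W (\sum_(i < D) \sum_s c i s *: (b s * f ^+ i)) ->
    forall i s, (i < D)%N -> c i s = 0.
  pose c' i s := if insub i is Some j then c (s, j) else 0 : F.
  have c'E (i : 'I_D) s : c' i s = c (s, i) by rewrite /c' valK.
  move=> [s i]; rewrite -c'E; apply: (indW c') => //.
  rewrite exchange_big pair_bigA /=; move: Wc; congr (vanish W _).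
  by apply: eq_bigr => -[t j] _ /=; rewrite c'E.
elim: D {c Wc} => // D IHD c Wc.
have {}Wc : vanish W (\sum_s c 0%N s *: b s +
    f * \sum_(i < D) \sum_s c i.+1 s *: (b s * f ^+ i)).
  move: Wc; congr (vanish W _); rewrite big_ord_recl /=; congr (_ + _).
    by apply: eq_bigr => s _; rewrite expr0 mulr1.
  rewrite mulr_sumr; apply: eq_bigr => i _; rewrite mulr_sumr.
  by apply: eq_bigr => s _; rewrite -scalerAr exprS mulrCA.
have c0 s : c 0%N s = 0.
  apply: indb => x Zx; have := Wc x (leZW x Zx).
  by rewrite mevalD mevalM Zf // mul0r addr0.
move: Wc; rewrite big1 ?add0r => [|s _]; last by rewrite c0 scale0r.
by move=> /(vanish_prime irrW)[//|/(IHD (fun i => c i.+1)) cS] [|i] s //; apply: cS.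
Qed.

Lemma msize_expM_le f g (i D : nat) :
  (i <= D)%N -> (msize (g * f ^+ i) <= msize g + D * (msize f).+1)%N.
Proof.
move=> leiD; apply: leq_trans (leq_add (leqnn _) (leq_mul leiD (leqnn _))).
elim: i {leiD} => [|i IHi]; first by rewrite expr0 mulr1 mul0n addn0.
rewrite exprSr mulrA; apply: leq_trans (msizeM_le _ _) _.
by rewrite -addnS mulSnr addnA leq_add2r.
Qed.

(** All exponents occurring in the [b s] are below [B], so the coefficient matrix has [B ^ n]
    columns; with more rows it would have a nonzero left kernel, that is, a linear dependency. *)
Lemma linindep_card (S : finType) (b : S -> {mpoly F[n]}) Z (B : nat) :
  linindep b Z -> (forall s, msize (b s) <= B)%N -> (#|S| <= B ^ n)%N.
Proof.
move=> indb leB; rewrite leqNgt; apply/negP => ltBS.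
pose T : finType := {ffun 'I_n -> 'I_B}.
pose mon (t : T) : 'X_{1..n} := [multinom val (t i) | i < n].
pose M : 'M[F]_(#|S|, #|T|) := \matrix_(i, j) (b (enum_val i))@_(mon (enum_val j)).
have : kermx M != 0.
  rewrite -mxrank_eq0 mxrank_ker subn_eq0 -ltnNge.
  by apply: leq_ltn_trans (rank_leq_col _) _; rewrite card_ffun !card_ord.
move=> /rowV0Pn[v /sub_kermxP vM v0].
have cb0 : \sum_s v 0 (enum_rank s) *: b s = 0.
  apply/mpolyP => m; rewrite mcoeff0 raddf_sum /=.
  have [/forallP ltm|/forallPn] := boolP [forall i, (m i < B)%N]; last first.
    case=> i; rewrite -leqNgt => leBm; apply: big1 => s _; rewrite mcoeffZ.
    rewrite memN_msupp_eq0 ?mulr0 //; apply/negP => /msize_mdeg_lt.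
    rewrite ltnNge (leq_trans (leB s)) // (leq_trans leBm) //.
    by rewrite mdegE (bigD1 i) //= leq_addr.
  pose t : T := [ffun i => Ordinal (ltm i)].
  have mt : mon t = m by apply/mnmP => i; rewrite mnmE ffunE.
  have := congr1 (fun N : 'rV[F]_#|T| => N 0 (enum_rank t)) vM.
  rewrite !mxE => {2}<-; rewrite (reindex_onto enum_val enum_rank) /=; last first.
    by move=> s _; rewrite enum_rankK.
  apply: eq_big => [i|i _]; first by rewrite enum_valK eqxx.
  by rewrite mcoeffZ enum_valK mxE enum_rankK mt.
case/eqP: v0; apply/rowP => j; rewrite mxE -[j]enum_valK.
apply: (indb (fun s => v 0 (enum_rank s))).
by rewrite cb0 => x _; rewrite meval0.
Qed.

(* Adding one element f_i of I(W i) outside I(W i.+1) at each step of a chain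
   preserves algebraic independence; it is expressed through the linear
   independence of the monomials with exponents smaller than D, so that a
   dimension count for D large bounds the length of the chain. *)
Lemma dominant_chain (m k : nat) (y : m.-tuple {mpoly F[n]})
    (W : nat -> set ('I_n -> F)) :
    dominant y (W 0%N) -> (forall i, (i <= k)%N -> irreducible_closed (W i)) ->
    (forall i, (i < k)%N -> W i `<` W i.+1) ->
  (m + k <= n)%N.
Proof.
move=> domW irrW ltW.
have [K indW] : exists K, forall D : nat, exists (S : finType)
    (b : S -> {mpoly F[n]}), [/\ #|S| = (D ^ (m + k))%N, linindep b (W k) &
      forall s, (msize (b s) <= (K * D).+1)%N].
  elim: k irrW ltW => [|k IHk] irrW ltW.
    (* For a chain of length 0, the family consists of the monomials in [y] with exponents below
       [D]. *)
    exists (\sum_(i < m) (msize (tnth y i)).+1)%N => D.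
    pose S : finType := {ffun 'I_m -> 'I_D}.
    pose mon (s : S) : 'X_{1..m} := [multinom val (s i) | i < m].
    have mon_inj : injective mon.
      move=> s t /mnmP eqst; apply/ffunP => i; apply/val_inj.
      by have := eqst i; rewrite !mnmE.
    exists S, (fun s => 'X_[mon s] \mPo y); split.
    - by rewrite card_ffun !card_ord addn0.
    - move=> c Wc s; have := domW (\sum_s c s *: 'X_[mon s]) _.
      rewrite raddf_sum /=; under eq_bigr do rewrite comp_mpolyZ.
      move=> /(_ Wc) /(congr1 (mcoeff (mon s))).
      rewrite mcoeff0 raddf_sum /= (bigD1 s) //= mcoeffZ mcoeffX eqxx mulr1.
      rewrite big1 ?addr0 // => t nets.
      by rewrite mcoeffZ mcoeffX (inj_eq mon_inj) (negPf nets) mulr0.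
    - move=> s; rewrite comp_mpolyX.
      suff: forall r : seq 'I_m, (msize (\prod_(i <- r) tnth y i ^+ mon s i)
          <= (\sum_(i <- r) (msize (tnth y i)).+1 * D).+1)%N.
        by move=> /(_ (index_enum 'I_m)); rewrite big_distrl.
      elim=> [|i r IHr]; first by rewrite !big_nil msize1.
      rewrite !big_cons mulrC.
      apply: leq_trans (@msize_expM_le _ _ _ D _) _; last first.
        by rewrite addnC mulnC -addnS leq_add2l.
      rewrite mnmE; exact: ltnW (ltn_ord _).
  have [||K IHK] := IHk.
  - by move=> i leik; apply/irrW/leqW.
  - by move=> i ltik; apply/ltW/leqW.
  have [leW /nonsubset[x [WSx nWx]]] := ltW k (ltnSn k).
  have [f Wf nWf] : exists2 f, vanish (W k) f & ~ vanish (W k.+1) f.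
    have [[S WE] _ _] := irrW k (leqnSn k).
    move: nWx; rewrite WE => /existsNP[f /not_implyP[Sf fx0]].
    exists f; first by move=> z; apply.
    by move/(_ x WSx).
  exists (K + (msize f).+1)%N => D; have [S [b [cardS indb leb]]] := IHK D.
  exists (S * 'I_D)%type, (fun s : S * 'I_D => b s.1 * f ^+ s.2); split.
  - by rewrite card_prod card_ord cardS addnS expnSr.
  - exact: (linindep_powers (irrW _ (leqnn _)) leW Wf nWf indb).
  - move=> [s i] /=; apply: leq_trans (msize_expM_le _ _ (ltnW (ltn_ord i))) _.
    by rewrite mulnDl -addSn (mulnC D) leq_add2r.
rewrite leqNgt; apply/negP => ltn.
(* If [n < m + k], the family has at least [D ^ n.+1] elements, but at most
   [(K * D).+1 ^ n <= K.+1 ^ n * D ^ n], which is smaller for this [D]. *)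
pose D := ((K.+1) ^ n).+1.
have [S [b [cardS indb leb]]] := indW D.
have := linindep_card indb leb; rewrite cardS leqNgt => /negP; apply.
apply: (@leq_trans (D ^ n.+1)%N); last by rewrite leq_pexp2l.
apply: (@leq_ltn_trans ((K.+1 * D) ^ n)%N).
  have [->|n_gt0] := posnP n; first by rewrite !expn0.
  by rewrite leq_exp2r // mulSn -add1n leq_add.
by rewrite expnMn expnS ltn_mul2r expn_gt0 ltnSn.
Qed.

End ZariskiClosed.

(** * Linear subspaces transversal to a cone *)

Section LinearSections.
Local Open Scope classical_set_scope.

Context (F : closedFieldType) (n c : nat) (V : set ('I_n -> F)).
Hypotheses (clV : zariski_closed V) (codimV : codim_ge c V).

(** Otherwise [V] is dominant and contains an irreducible dominant [W0]; the chain of length at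
    least [c] above [W0] contradicts [dominant_chain]. *)
Lemma codim_ge_relation (m : nat) (y : m.-tuple {mpoly F[n]}) :
  (n < m + c)%N -> exists2 q : {mpoly F[m]}, q != 0 & vanish V (q \mPo y).
Proof.
move=> ltn; apply: contrapT => noq.
have domV : dominant y V.
  by move=> q Vq; apply: contrapT => /eqP q0; apply: noq; exists q.
have [W0 [irrW0 leW0 domW0]] := dominant_irreducible clV domV.
have [k leck [W [W0E irrW ltW]]] := codimV irrW0 leW0.
rewrite -W0E in domW0.
have := dominant_chain domW0 irrW ltW; rewrite leqNgt => /negP; apply.
by apply: leq_trans ltn _; rewrite leq_add2l.
Qed.

Definition linear_forms (k m : nat) (U : 'M[F]_(k, m)) : m.-tuple {mpoly F[k]} :=
  [tuple \sum_j U j i *: 'X_j | i < m].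

Lemma meval_linear_forms (k m : nat) (U : 'M[F]_(k, m)) (q : {mpoly F[m]})
  (v : 'rV_k) : (q \mPo linear_forms U).@[v 0] = q.@[(v *m U) 0].
Proof.
rewrite comp_mpoly_meval; apply: meval_eq => i; rewrite tnth_mktuple mxE.
rewrite raddf_sum /=; apply: eq_bigr => j _.
by rewrite mevalZ mevalXU mulrC.
Qed.

(** [q] is pulled back along the projection [B] onto the quotient by the row space of [U]. The
    quotient has dimension at least [n - k > n - c], which forces a relation on [V]; the pullback is
    nonzero because [B] is onto. *)
Lemma codim_ge_invariant (k : nat) (U : 'M[F]_(k, n)) : (k < c)%N ->
  exists q : {mpoly F[n]}, [/\ q != 0, vanish V q &
    forall (v : 'rV_n) a, q.@[(v + a *m U) 0] = q.@[v 0]].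
Proof.
move=> ltkc; pose B := col_base (cokermx U).
have UB : U *m B = 0.
  have := mulmx_coker U; rewrite -{1}(mulmx_base (cokermx U)) mulmxA.
  move/(congr1 (fun M => M *m pinvmx (row_base (cokermx U)))).
  by rewrite mul0mx -mulmxA mulmxVp ?row_base_free // mulmx1.
have [|q q0 Vq] := codim_ge_relation (linear_forms B).
  apply: (@leq_ltn_trans (\rank (cokermx U) + k)); last by rewrite ltn_add2l.
  rewrite mxrank_coker; have := rank_leq_row U; have := rank_leq_col U; lia.
exists (q \mPo linear_forms B); split=> // [|v a]; last first.
  by rewrite !meval_linear_forms mulmxDl -mulmxA UB mulmx0 addr0.
have [v] := mpoly_nonroot q0; apply: contraNneq => qB0.
have := meval_linear_forms B q ((\row_i v i) *m pinvmx B).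
rewrite qB0 meval0 -mulmxA mulVpmx ?col_base_full // mulmx1 => ->.
by apply/eqP/meval_eq => i; rewrite mxE.
Qed.

Hypothesis coneV : forall t (v : 'rV_n), V (v 0) -> V ((t *: v) 0).

(* A vector outside the zero set of an equation of V that is invariant along U
   enlarges U without creating an intersection with the cone V. *)
Lemma codim_ge_transversal (h : {mpoly F[n]}) : (0 < c)%N -> h != 0 ->
  exists U : 'M[F]_(c, n), (forall a : 'rV_c, V ((a *m U) 0) -> a = 0) /\
    exists a : 'rV_c, h.@[(a *m U) 0] != 0.
Proof.
move=> c_gt0 h0.
(* The condition on [h] is restricted to [0 < k], since without rows the only vector is 0. *)
suff step k : (k <= c)%N -> exists U : 'M[F]_(k, n),
    (forall a : 'rV_k, V ((a *m U) 0) -> a = 0) /\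
    ((0 < k)%N -> exists a : 'rV_k, h.@[(a *m U) 0] != 0).
  by have [U [? /(_ c_gt0)]] := step c (leqnn c); exists U.
elim: k => [_|k IHk ltkc].
  by exists 0; split=> // a _; apply/rowP => -[].
have [U [UV _]] := IHk (ltnW ltkc).
have [q [q0 Vq qU]] := codim_ge_invariant U ltkc.
have [u] : exists u : 'I_n -> F, (h * q).@[u] != 0.
  by apply: mpoly_nonroot; rewrite mulf_neq0.
rewrite mevalM mulf_eq0 negb_or => /andP[hu qu].
suff [U' [U'V hU']] : exists U' : 'M[F]_(1 + k, n),
    (forall a : 'rV_(1 + k), V ((a *m U') 0) -> a = 0) /\
    exists a : 'rV_(1 + k), h.@[(a *m U') 0] != 0.
  by exists U'; split.
exists (col_mx (\row_i u i) U); split=> [a|]; last first.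
  exists (row_mx 1%:M 0); rewrite mul_row_col mul1mx mul0mx addr0.
  by apply: contraNneq hu => <-; apply/eqP/meval_eq => i; rewrite mxE.
rewrite -[a]hsubmxK mul_row_col.
rewrite [lsubmx a]mx11_scalar mul_scalar_mx => Va.
have [t0|t0] := eqVneq (lsubmx a 0 0) 0.
  rewrite t0 scale0r add0r in Va.
  by rewrite t0 (UV _ Va) raddf0 row_mx0.
(* The cone property scales the coefficient of [u] to 1; then [q] vanishes at a translate of [u]
   along [U], hence at [u]. *)
have := coneV (lsubmx a 0 0)^-1 Va.
rewrite scalerDr scalerA mulVf // scale1r scalemxAl.
move=> /Vq; rewrite qU => q0u; case/eqP: qu; rewrite -q0u.
by apply: meval_eq => i; rewrite mxE.
Qed.

End LinearSections.

(** * The homogeneous Nullstellensatz *)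

Section HomogeneousNullstellensatz.
Local Open Scope classical_set_scope.

Lemma pihomogM_homog (R : comNzRingType) (n d e : nat) (a c : {mpoly R[n]}) :
  a \is e.-homog ->
  pihomog mdeg d (c * a) = if (e <= d)%N then pihomog mdeg (d - e) c * a else 0.
Proof.
(* [k] bounds the size of [c] and exceeds [d], so that the index [d - e] occurs in the decomposition
   of [c]. *)
move=> ha; pose k := maxn (msize c) d.+1.
have lek : (msize c <= k)%N := leq_maxl _ _.
rewrite {1}(pihomog_partitionE lek) mulr_suml raddf_sum /=.
have term i : pihomog mdeg d (pihomog mdeg i c * a) =
    if (i + e == d)%N then pihomog mdeg i c * a else 0.
  have hia := dhomogM (pihomogP mdeg i c) ha.
  case: eqP => [<-|/eqP ne]; first by rewrite pihomog_dE.
  by rewrite (pihomog_ne0 ne hia).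
under eq_bigr do rewrite term.
case: ifP => led; last first.
  by apply: big1 => i _; case: eqP => // eqd; rewrite -eqd leq_addl in led.
have ltk : (d - e < k)%N by rewrite leq_max ltnS leq_subr orbT.
rewrite (bigD1 (Ordinal ltk)) //= subnK // eqxx big1 ?addr0 // => i nei.
case: eqP => // eqd; case/eqP: nei; apply/val_inj => /=; lia.
Qed.

(** This homogenizes a split monic polynomial to degree [D]. A further factor ['X - z%:P] shifts the
    coefficients, which multiplies the form by [w], and subtracts [z] times them, which accounts for
    [emb z * x]. *)
Lemma sum_homogenize_roots (R A : comNzRingType) (emb : {rmorphism R -> A})
    (x w : A) (r : seq R) (D : nat) : (size r <= D)%N ->
  \sum_(i < D.+1) emb (\prod_(z <- r) ('X - z%:P))`_i * (x ^+ (D - i) * w ^+ i) =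
  x ^+ (D - size r) * \prod_(z <- r) (w - emb z * x).
Proof.
elim: r D => [|z r IHr] D ltD.
  rewrite !big_nil big_ord_recl coef1 /= rmorph1 mul1r !subn0 expr0 !mulr1.
  by rewrite big1 ?addr0 // => i _; rewrite coef1 rmorph0 mul0r.
case: D ltD => // D leD; rewrite !big_cons; set g := \prod_(_ <- r) _.
have gD : g`_D.+1 = 0 by rewrite nth_default // size_prod_XsubC.
have := IHr D leD; rewrite -/g => IHD.
rewrite [RHS]mulrCA /= subSS -IHD [RHS]mulrBl.
have -> : w * (\sum_(i < D.+1) emb g`_i * (x ^+ (D - i) * w ^+ i)) =
    \sum_(i < D.+2) emb ('X * g)`_i * (x ^+ (D.+1 - i) * w ^+ i).
  rewrite [RHS]big_ord_recl coefXM /= rmorph0 mul0r add0r mulr_sumr.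
  by apply: eq_bigr => i _; rewrite coefXM /= subSS exprS; ring.
have -> : emb z * x * (\sum_(i < D.+1) emb g`_i * (x ^+ (D - i) * w ^+ i)) =
    \sum_(i < D.+2) emb (z%:P * g)`_i * (x ^+ (D.+1 - i) * w ^+ i).
  rewrite [RHS]big_ord_recr /= coefCM gD mulr0 rmorph0 mul0r addr0 mulr_sumr.
  apply: eq_bigr => i _; rewrite coefCM rmorphM subSn ?exprS; last first.
    by rewrite -ltnS ltn_ord.
  ring.
rewrite -sumrB; apply: eq_bigr => i _.
by rewrite -mulrBl -rmorphB -coefB -mulrBl.
Qed.

Context (F : closedFieldType) (n : nat).
Implicit Types (I J : set {mpoly F[n]}) (a b f g : {mpoly F[n]}).

Definition homog_mideal I : Prop :=
  mideal I /\ forall d f, I f -> I (pihomog mdeg d f).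

Definition adjoin I a : set {mpoly F[n]} :=
  [set g | exists b c, I b /\ g = b + c * a].

Lemma adjoin_homog_mideal I a e :
  homog_mideal I -> a \is e.-homog -> homog_mideal (adjoin I a).
Proof.
move=> [[I0 ID IM] Ipi] ha; split; first split.
- by exists 0, 0; rewrite mul0r addr0.
- move=> _ _ [b [c [Ib ->]]] [b' [c' [Ib' ->]]]; exists (b + b'), (c + c').
  by split; [exact: ID | ring].
- move=> f _ [b [c [Ib ->]]]; exists (f * b), (f * c).
  by split; [exact: IM | ring].
- move=> d _ [b [c [Ib ->]]]; rewrite pihomogD (pihomogM_homog _ _ ha).
  exists (pihomog mdeg d b), (if (e <= d)%N then pihomog mdeg (d - e) c else 0).
  by split; [exact: Ipi | case: ifP => _ //; rewrite mul0r].
Qed.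

Lemma sub_adjoin I a : I `<=` adjoin I a.
Proof. by move=> b Ib; exists b, 0; rewrite mul0r addr0. Qed.

Lemma mem_adjoin I a : mideal I -> adjoin I a a.
Proof. by move=> [I0 _ _]; exists 0, 1; rewrite mul1r add0r. Qed.

(** * Homogeneous ideals maximal among those containing no power of the irrelevant ideal *)

Section MaximalIrrelevantFree.

Context (I : set {mpoly F[n]}) (idI : homog_mideal I).
Hypothesis powI : forall N, exists i, ~ I ('X_i ^+ N).
Hypothesis maxI : forall J, homog_mideal J -> I `<=` J ->
  (forall N, exists i, ~ J ('X_i ^+ N)) -> J `<=` I.

Let I0 : I 0. Proof. by case: idI => -[]. Qed.
Let ID a b : I a -> I b -> I (a + b). Proof. by case: idI => -[_ + _] _; apply. Qed.
Let IM a b : I b -> I (a * b). Proof. by case: idI => -[_ _ +] _; apply. Qed.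
Let IMr a b : I a -> I (a * b). Proof. by rewrite mulrC; apply: IM. Qed.
Let IZ k a : I a -> I (k *: a). Proof. by rewrite -mul_mpolyC; apply: IM. Qed.
Let IN a : I a -> I (- a). Proof. by rewrite -mulN1r; apply: IM. Qed.
Let IB a b : I a -> I b -> I (a - b). Proof. by move=> Ia /IN; apply: ID. Qed.
Let Isum (T : Type) (r : seq T) (G : T -> {mpoly F[n]}) :
  (forall t, I (G t)) -> I (\sum_(t <- r) G t).
Proof. by move=> IG; elim/big_ind: _ => //; apply: ID. Qed.

Lemma adjoin_powers a e : a \is e.-homog -> ~ I a ->
  exists N, forall i, adjoin I a ('X_i ^+ N).
Proof.
move=> ha nIa; apply: contrapT => nopow; apply: nIa.
apply: (maxI (adjoin_homog_mideal idI ha) (@sub_adjoin I a)); last first.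
  by apply: mem_adjoin; case: idI.
move=> N; apply: contrapT => /forallNP nex; apply: nopow; exists N => i.
exact: contrapT (nex i).
Qed.

(** If neither factor is in [I], maximality puts powers of all variables in [adjoin I a] and in
    [adjoin I b]; the product of these two ideals lies in [I], against [powI]. *)
Lemma maximal_homog_prime a b d e : a \is d.-homog -> b \is e.-homog ->
  I (a * b) -> I a \/ I b.
Proof.
move=> ha hb Iab; apply: contrapT => /not_orP[nIa nIb].
have [N powa] := adjoin_powers ha nIa; have [N' powb] := adjoin_powers hb nIb.
case: (powI (N + N')) => i; apply; rewrite exprD.
have [f [c [If ->]]] := powa i; have [f' [c' [If' ->]]] := powb i.
have -> : (f + c * a) * (f' + c' * b) =
  f * (f' + c' * b) + (c * a * f' + c * c' * (a * b)) by ring.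
by apply: ID; [exact: IMr | apply: ID; apply: IM].
Qed.

Lemma homog_Xi i : ('X_i : {mpoly F[n]}) \is 1.-homog.
Proof. by rewrite dhomogX /= mdeg1. Qed.

Lemma homog_prime_exp a d N : a \is d.-homog -> I (a ^+ N) -> I a \/ I 1.
Proof.
move=> ha; elim: N => [|N IHN]; first by rewrite expr0; right.
rewrite exprS => /(maximal_homog_prime ha (dhomogMn N ha))[]; first by left.
exact: IHN.
Qed.

Context (i0 : 'I_n) (nIx : ~ I 'X_i0).
Local Notation x := ('X_i0 : {mpoly F[n]}).

Let nI1 : ~ I 1. Proof. by move=> I1; apply: nIx; rewrite -[x]mulr1; apply: IM. Qed.

(** By maximality [adjoin I x] contains all ['X_i ^+ N], hence every monomial of degree at least
    [n * N]. A form of larger degree is thus a multiple of [x] modulo [I], and this is iterated. *)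
Lemma reduce_homog : exists M, forall j f, f \is (M + j).-homog ->
  exists2 r, r \is M.-homog & I (f - x ^+ j * r).
Proof.
have [N pow] := adjoin_powers (homog_Xi i0) nIx.
have idA := adjoin_homog_mideal idI (homog_Xi i0).
have [[A0 AD AM] _] := idA.
exists (n * N)%N; elim=> [|j IHj] f hf.
  by exists f; [rewrite addn0 in hf | rewrite expr0 mul1r subrr].
have [b [c [Ib fE]]] : adjoin I x f.
  rewrite (mpolyE f) big_seq; elim/big_ind: _ => // m fm.
  have [i leNi] : exists i, (N <= m i)%N.
    apply/existsP; apply: contraT => /existsPn ltN.
    have : (mdeg m < n * N)%N.
      apply: (@leq_ltn_trans (\sum_(i < n) N.-1)).
        by rewrite mdegE; apply: leq_sum => i _; have := ltN i; lia.
      rewrite sum_nat_const card_ord; have := ltN i0; have := ltn_ord i0; nia.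
    by rewrite (dhomogP _ _ _ hf m fm) ltnNge leq_addr.
  have leU : (U_(i) *+ N <= m)%MM.
    apply/mnm_lepP => k; rewrite mulmnE mnm1E.
    by case: eqP => [<-|_]; rewrite ?mul1n ?mul0n.
  rewrite -mul_mpolyC -(submK leU) mpolyXD -mpolyXn mulrA.
  exact: AM.
(* Passing to components of the right degree makes the cofactor of [x] homogeneous. *)
have {}fE : f = pihomog mdeg (n * N + j).+1 b + pihomog mdeg (n * N + j) c * x.
  rewrite addnS in hf; rewrite -(pihomog_dE hf) {1}fE pihomogD.
  by rewrite (pihomogM_homog _ _ (homog_Xi i0)) /= subn1.
have [r hr Ir] := IHj _ (pihomogP mdeg (n * N + j) c).
exists r => //; rewrite fE exprS.
set c' := pihomog _ _ c in Ir *.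
have -> : pihomog mdeg (n * N + j).+1 b + c' * x - x * x ^+ j * r =
  pihomog mdeg (n * N + j).+1 b + x * (c' - x ^+ j * r) by ring.
by apply: ID; [case: idI => _; apply | apply: IM].
Qed.

(* The monomials of a large degree D in 'X_i0 and 'X_j are dependent modulo I;
   the dependency is a binary form, which splits into linear factors. *)
Lemma linear_form_mem j : exists z : F, I ('X_j - z *: x).
Proof.
have [M red] := reduce_homog.
have n_gt0 : (0 < n)%N by apply: leq_ltn_trans (ltn_ord i0).
(* By [linindep_card], [D] bounds the number of independent forms of degree [M], and there are
   [D.+1] remainders [r s]. *)
pose D := (M.+1 ^ n)%N.
have leMD : (M <= D)%N.
  by apply: leq_trans (leqnSn M) _; rewrite -{1}(expn1 M.+1) leq_pexp2l.
pose w := 'X_j : {mpoly F[n]}.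
have mon_homog (s : 'I_D.+1) : x ^+ (D - s) * w ^+ s \is (M + (D - M)).-homog.
  rewrite subnKC //.
  have := dhomogM (dhomogMn (D - s) (homog_Xi i0)) (dhomogMn s (homog_Xi j)).
  by rewrite !mul1n subnK // -ltnS ltn_ord.
pose r s := s2val (cid2 (red _ _ (mon_homog s))).
have r_homog s : r s \is M.-homog by rewrite /r; case: (cid2 _).
have Ir (s : 'I_D.+1) : I (x ^+ (D - s) * w ^+ s - x ^+ (D - M) * r s).
  by rewrite /r; case: (cid2 _).
have [c [s cs0] rc0] : exists2 c : 'I_D.+1 -> F, exists s, c s != 0 &
    \sum_s c s *: r s = 0.
  apply: contrapT => noc.
  have : linindep r [set: 'I_n -> F]%classic.
    move=> c rc s; apply: contrapT => /eqP cs0; apply: noc; exists c.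
      by exists s.
    apply: contrapT => /eqP/mpoly_nonroot[v] /eqP; apply.
    exact: rc.
  move/linindep_card => card_r; suff /card_r : forall s, (msize (r s) <= M.+1)%N.
    by rewrite card_ord ltnn.
  move=> s; rewrite msizeE big_seq; apply/bigmax_leqP_seq => m rm _.
  by rewrite (dhomogP _ _ _ (r_homog s) m rm).
pose p : {poly F} := \poly_(k < D.+1) c (inord k).
have p0 : p != 0.
  apply: contraNneq cs0 => p0; have := congr1 (fun q : {poly F} => q`_s) p0.
  by rewrite coef0 coef_poly ltn_ord inord_val => ->.
have Ip : I (\sum_(s < D.+1) p`_s *: (x ^+ (D - s) * w ^+ s)).
  rewrite [X in I X](_ : _ = \sum_(s < D.+1)
      c s *: (x ^+ (D - s) * w ^+ s - x ^+ (D - M) * r s)).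
    by apply: Isum => t; apply: IZ.
  under [RHS]eq_bigr do rewrite scalerBr.
  rewrite sumrB [X in _ - X](_ : _ = 0) ?subr0; last first.
    by under eq_bigr do rewrite scalerAr; rewrite -mulr_sumr rc0 mulr0.
  by apply: eq_bigr => t _; rewrite coef_poly ltn_ord inord_val.
have lc0 : lead_coef p != 0 by rewrite lead_coef_eq0.
have [rs] := closed_field_poly_normal p; move: (lead_coef p) lc0 => lc lc0 pE.
have size_rs : (size rs <= D)%N.
  have := size_poly D.+1 (fun k => c (inord k)); rewrite -/p pE size_scale //.
  by rewrite size_prod_XsubC.
have {}Ip : I (x ^+ (D - size rs) * \prod_(z <- rs) (w - z%:MP * x)).
  rewrite -(sum_homogenize_roots (@mpolyC n F) _ _ size_rs).
  have := IZ lc^-1 Ip; congr (I _).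
  rewrite scaler_sumr; apply: eq_bigr => t _.
  by rewrite pE coefZ scalerA (mulrA lc^-1) mulVf ?mul1r ?mul_mpolyC.
have lin_homog z : w - z%:MP * x \is 1.-homog.
  by rewrite rpredB ?mul_mpolyC ?rpredZ // homog_Xi.
(* By primality some factor is in [I]; it cannot be a power of [x]. *)
have {Ip} : exists z, I (w - z%:MP * x).
  apply: contrapT => /forallNP noz.
  have prod_homog (l : seq F) :
      \prod_(z <- l) (w - z%:MP * x) \is (size l).-homog.
    elim: l => [|z l IHl]; first by rewrite big_nil dhomog1.
    by rewrite big_cons; apply: (dhomogM (lin_homog z) IHl).
  have prodN (l : seq F) : ~ I (\prod_(z <- l) (w - z%:MP * x)).
    elim: l => [|z l IHl]; first by rewrite big_nil.
    by rewrite big_cons => /(maximal_homog_prime (lin_homog z) (prod_homog l))[/noz|].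
  have := maximal_homog_prime (dhomogMn (D - size rs) (homog_Xi i0)) (prod_homog rs) Ip.
  by case=> [/(homog_prime_exp (homog_Xi i0))[]|/prodN].
by case=> z; exists z; rewrite -mul_mpolyC.
Qed.

(* 'X_j is congruent to z j *: 'X_i0 modulo I, so f is congruent to
   f.@[z] *: 'X_i0 ^+ d, and no power of 'X_i0 is in I. *)
Lemma linear_forms_zero (z : 'I_n -> F) d f :
  (forall j, I ('X_j - z j *: x)) -> f \is d.-homog -> I f -> f.@[z] = 0.
Proof.
move=> Iz hf If.
have IX m : I ('X_[m] - (\prod_(i < n) z i ^+ m i) *: x ^+ mdeg m).
  have -> : (\prod_(i < n) z i ^+ m i) *: x ^+ mdeg m =
      \prod_(i < n) (z i *: x) ^+ m i.
    rewrite mdegE expr_sum -mul_mpolyC rmorph_prod -big_split /=.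
    by apply: eq_bigr => i _; rewrite exprZn -mul_mpolyC.
  rewrite mpolyXE_id; elim/big_rec2: _ => [|i u v _ Iuv]; first by rewrite subrr.
  have Imul (g h g' h' : {mpoly F[n]}) : I (g - h) -> I (g' - h') ->
      I (g * g' - h * h').
    move=> Igh Igh'; have -> : g * g' - h * h' = g * (g' - h') + (g - h) * h' by ring.
    by apply: ID; [apply: IM | apply: IMr].
  apply: (Imul) => //; elim: (m i) => [|k IHk]; first by rewrite !expr0 subrr.
  by rewrite !exprS; apply: (Imul).
have Ifz : I (f.@[z] *: x ^+ d).
  suff IB' : I (f - f.@[z] *: x ^+ d) by rewrite -[X in I X](subKr f); apply: IB.
  rewrite {1}(mpolyE f) mevalE scaler_suml -sumrB big_seq.
  elim/big_ind: _ => // m fm.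
  by rewrite -scalerA -scalerBr -(dhomogP _ _ _ hf m fm); apply: IZ.
apply: contrapT => /eqP fz0; have := IZ (f.@[z])^-1 Ifz.
by rewrite scalerA mulVf // scale1r => /(homog_prime_exp (homog_Xi i0))[].
Qed.

End MaximalIrrelevantFree.

(** Enlarge [J] to a maximal [I] and take ['X_i0] outside [I]. The ratios [z j] of the variables to
    ['X_i0] modulo [I] form a zero of [J], so [z i0 = 0], which puts ['X_i0] in [I]. *)
Theorem homog_nullstellensatz J : homog_mideal J ->
    (forall v, (forall f, J f -> f.@[v] = 0) -> forall i, v i = 0) ->
  exists N, forall i, J ('X_i ^+ N).
Proof.
move=> [idJ homJ] noJ; apply: contrapT => nopow.
pose A := [set I | [/\ homog_mideal I, J `<=` I &
  forall N, exists i, ~ I ('X_i ^+ N)]].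
have [||I [idI leJI powI] maxI] := @mideal_maximal F n A.
- exists J; split=> // N; apply: contrapT => /forallNP nex; apply: nopow.
  by exists N => i; apply: contrapT (nex i).
- by move=> I [[]].
have {}maxI K : homog_mideal K -> I `<=` K ->
    (forall N, exists i, ~ K ('X_i ^+ N)) -> K `<=` I.
  by move=> idK leIK powK; apply: maxI => //; split=> // f /leJI /leIK.
have [i0] := powI 1%N; rewrite expr1 => nIx.
pose z j := sval (cid (linear_form_mem idI powI maxI nIx j)).
have Iz j : I ('X_j - z j *: 'X_i0) by rewrite /z; case: (cid _).
have z0 : z i0 = 0.
  apply: noJ => f Jf; rewrite (pihomog_partitionE (leqnn (msize f))) raddf_sum /=.
  apply: big1 => d _.
  apply: (linear_forms_zero idI powI maxI nIx Iz (pihomogP mdeg d f)).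
  exact/leJI/homJ.
by apply: (nIx); have := Iz i0; rewrite z0 scale0r subr0.
Qed.

End HomogeneousNullstellensatz.

(** * The Koszul complex in degree 2 *)

(* A relation "p /\ t = 0" for a 2-form t is divisible by p when the ideal of
   the coefficients of p contains a regular sequence x, y, z: contracting the
   relation with the vectors a, b, c gives x t = p /\ i_a t,
   y i_a t - x i_b t = t(a, b) p and z t(a, b) in (x, y). *)
Lemma koszul2_exact (R : idomainType) (n : nat) (p a b c : 'I_n -> R)
    (t : 'I_n -> 'I_n -> R) :
  let x := \sum_j a j * p j in let y := \sum_j b j * p j in
  let z := \sum_j c j * p j in
  x != 0 ->
  (forall f g, y * f = x * g -> exists h, f = x * h) ->
  (forall f u v, z * f = x * u + y * v -> exists u' v', f = x * u' + y * v') ->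
  (forall j k l, p j * t k l - p k * t j l + p l * t j k = 0) ->
  exists r, forall k l, t k l = p k * r l - p l * r k.
Proof.
move=> x y z x0 regxy regxyz pt.
pose ta l := \sum_j a j * t j l; pose tb l := \sum_j b j * t j l.
pose tab := \sum_k b k * ta k.
have xt k l : x * t k l = p k * ta l - p l * ta k.
  apply/eqP; rewrite -subr_eq0 /x /ta !mulr_sumr mulr_suml -!sumrB.
  apply/eqP/big1 => j _; rewrite -[RHS](mulr0 (a j)) -(pt j k l); ring.
have yx l : y * ta l - x * tb l = tab * p l.
  apply/eqP; rewrite -subr_eq0 /y /tb /tab mulr_sumr !mulr_suml -!sumrB.
  apply/eqP/big1 => k _; rewrite mulrCA xt; ring.
have ztab : z * tab = x * (- \sum_l c l * tb l) + y * (\sum_l c l * ta l).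
  rewrite mulrN addrC /z mulr_suml !mulr_sumr -sumrB; apply: eq_bigr => l _.
  by rewrite -mulrA [p l * _]mulrC -yx; ring.
have [u [v tabE]] := regxyz _ _ _ ztab.
(* Substituting [tabE] in [yx] gives [y * (ta l - v * p l) = x * (tb l + u * p l)]. The correction
   [v * p l] cancels in the antisymmetric expression for [x * t k l]. *)
have xr l : exists r, ta l - v * p l = x * r.
  apply: (regxy _ (tb l + u * p l)); have := yx l; rewrite tabE => yxl.
  apply/eqP; rewrite -subr_eq0; apply/eqP.
  rewrite -[RHS](subrr (y * ta l - x * tb l)) {2}yxl; ring.
have /choice[r rE] := xr; exists r => k l; apply: (mulfI x0); rewrite xt.
have taE m : ta m = x * r m + v * p m by rewrite -rE subrK.
by rewrite !taE; ring.
Qed.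

(** * Regular sequences of powers of variables *)

Lemma mcoeffXM (R : comNzRingType) (n : nat) (g : {mpoly R[n]}) (u m : 'X_{1..n}) :
  ('X_[u] * g)@_m = if (u <= m)%MM then g@_(m - u) else 0.
Proof.
rewrite mulrC; case: ifP => [leum|nleum].
  by rewrite -{1}(submK leum) addmC mcoeffMX.
apply: memN_msupp_eq0; rewrite (perm_mem (msuppMX _ _)); apply/mapP => -[m' _ eqm].
by rewrite eqm lem_addr in nleum.
Qed.

Section PowersOfVariables.

Context (R : comNzRingType) (n N : nat).
Implicit Types (f g u v : {mpoly R[n]}) (i j k : 'I_n).

Lemma mcoeffXiM f i m :
  ('X_i ^+ N * f)@_m = if (N <= m i)%N then f@_(m - U_(i) *+ N) else 0.
Proof.
rewrite mpolyXn mcoeffXM; congr (if _ then _ else _).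
apply/mnm_lepP/idP => [/(_ i)|leN k].
  by rewrite mulmnE mnm1E eqxx mul1n.
by rewrite mulmnE mnm1E; case: eqP => [<-|_]; rewrite ?mul1n ?mul0n.
Qed.

Lemma monomial_ideal2 f i j :
    (forall m, m \in msupp f -> (N <= m i)%N || (N <= m j)%N) ->
  exists u v, f = 'X_i ^+ N * u + 'X_j ^+ N * v.
Proof.
have powX k (m : 'X_{1..n}) : (N <= m k)%N -> exists u, 'X_[m] = 'X_k ^+ N * u.
  move=> leN; exists 'X_[m - U_(k) *+ N]; apply/mpolyP => m'.
  rewrite mcoeffXiM !mcoeffX; case: ifP => [leN'|nleN']; last first.
    by case: eqP => // eqm; rewrite -eqm leN in nleN'.
  have shiftK (w : 'X_{1..n}) : (N <= w k)%N -> (w - U_(k) *+ N + U_(k) *+ N)%MM = w.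
    move=> leNw; apply/submK/mnm_lepP => l; rewrite mulmnE mnm1E.
    by case: eqP => [<-|_]; rewrite ?mul1n ?mul0n.
  congr (nat_of_bool _)%:R; apply/idP/idP => [/eqP->//|/eqP/(congr1 (+%MM^~ (U_(k) *+ N)%MM))].
  by rewrite !shiftK // => ->.
move=> suppf; rewrite (mpolyE f) big_seq.
elim/big_ind: _ => [|f1 f2 [u1 [v1 ->]] [u2 [v2 ->]]|m fm].
- by exists 0, 0; rewrite !mulr0 addr0.
- by exists (u1 + u2), (v1 + v2); ring.
- have /orP[/powX[u ->]|/powX[u ->]] := suppf m fm; rewrite scalerAr.
    by exists (f@_m *: u), 0; rewrite mulr0 addr0.
  by exists 0, (f@_m *: u); rewrite mulr0 add0r.
Qed.

Lemma regular_powers3 f u v i j k : k != i -> k != j ->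
    'X_k ^+ N * f = 'X_i ^+ N * u + 'X_j ^+ N * v ->
  exists u' v', f = 'X_i ^+ N * u' + 'X_j ^+ N * v'.
Proof.
move=> neki nekj eqf; apply: monomial_ideal2 => m; rewrite mcoeff_msupp.
apply: contraNT; rewrite negb_or => /andP[nlei nlej].
have := congr1 (mcoeff (m + U_(k) *+ N)) eqf.
rewrite mcoeffD !mcoeffXiM addmK !mnmDE !mulmnE !mnm1E eqxx mul1n leq_addl.
by rewrite (negPf neki) (negPf nekj) !mul0n !addn0 (negPf nlei) (negPf nlej) addr0 => ->.
Qed.

Lemma regular_powers2 f g i j : j != i ->
  'X_j ^+ N * f = 'X_i ^+ N * g -> exists h, f = 'X_i ^+ N * h.
Proof.
move=> neji eqf; have [|u [v ->]] := @regular_powers3 f g 0 i i j neji neji.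
  by rewrite mulr0 addr0.
by exists (u + v); rewrite mulrDr.
Qed.

End PowersOfVariables.

(** * Homogeneous polynomials and the vanishing of low-degree Koszul cycles *)

Lemma meval_homog (R : comNzRingType) (n d : nat) (f : {mpoly R[n]}) s (v : 'rV_n) :
  f \is d.-homog -> f.@[(s *: v) 0] = s ^+ d * f.@[v 0].
Proof.
move=> hf; rewrite !mevalE mulr_sumr big_seq [RHS]big_seq; apply: eq_bigr => m fm.
have <- : mdeg m = d := dhomogP _ _ _ hf m fm.
rewrite mulrCA mdegE expr_sum -big_split /=.
by congr (_ * _); apply: eq_bigr => i _; rewrite mxE exprMn.
Qed.

Lemma comp_mpoly_homog (R : comNzRingType) (n k d : nat) (f : {mpoly R[n]})
    (lq : n.-tuple {mpoly R[k]}) :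
  (forall i, tnth lq i \is 1.-homog) -> f \is d.-homog -> f \mPo lq \is d.-homog.
Proof.
move=> hlq hf; rewrite comp_mpolyEX big_seq; apply: rpred_sum => m fm.
apply: rpredZ; have <- : mdeg m = d := dhomogP _ _ _ hf m fm.
rewrite comp_mpolyX mdegE.
elim/big_rec2: _ => [|i e g _ hg]; first exact: dhomog1.
by apply: dhomogM => //; have := dhomogMn (m i) (hlq i); rewrite mul1n.
Qed.

(** For [d = 0] the derivative is 0, so the truncated [d.-1] is harmless. *)
Lemma mderiv_homog (R : comNzRingType) (n d : nat) (f : {mpoly R[n]}) i :
  f \is d.-homog -> f^`M(i) \is d.-1.-homog.
Proof.
move=> hf; apply/dhomogP => m; rewrite mcoeff_msupp mcoeff_mderiv => fm0.
have : (m + U_(i))%MM \in msupp f.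
  by rewrite mcoeff_msupp; apply: contraNneq fm0 => ->; rewrite mul0rn.
by move/(dhomogP _ _ _ hf) => <- /=; rewrite mdegD mdeg1 addn1.
Qed.

Lemma euler_homog (R : comNzRingType) (n d : nat) (f : {mpoly R[n]}) :
  f \is d.-homog -> \sum_i 'X_i * f^`M(i) = f *+ d.
Proof.
move=> hf; apply/mpolyP => m; rewrite raddf_sum mcoeffMn /=.
have term i : ('X_i * f^`M(i))@_m = f@_m *+ m i.
  rewrite mcoeffXM lep1mP; case: eqP => [->|/eqP mi0]; first by rewrite mulr0n.
  rewrite mcoeff_mderiv submK ?lep1mP // mnmBE mnm1E eqxx subn1 prednK //.
  by rewrite lt0n.
under eq_bigr do rewrite term.
rewrite sumrMnr.
have [fm|/memN_msupp_eq0 ->] := boolP (m \in msupp f); last first.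
  by rewrite !mul0rn.
by rewrite -mdegE (_ : mdeg m = d) //; apply: dhomogP hf m fm.
Qed.

(* The degree argument: p wedge r has order at least d.+1, so it vanishes in
   degree d. *)
Lemma low_degree_koszul2_eq0 (F : closedFieldType) (n d : nat)
    (p : 'I_n -> {mpoly F[n]}) (t : 'I_n -> 'I_n -> {mpoly F[n]}) :
    (forall l, p l \is d.+1.-homog) -> (forall k l, t k l \is d.-homog) ->
    codim_ge 3 [set x : 'I_n -> F | forall l, (p l).@[x] = 0]%classic ->
    (forall j k l, p j * t k l - p k * t j l + p l * t j k = 0) ->
  forall k l, t k l = 0.
Proof.
set V := [set x | _]%classic => hp ht codimV pt k l.
have clV : zariski_closed V.
  exists (range p); apply/seteqP; split=> x Vx; first by move=> _ [i _ <-].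
  by move=> i; apply: Vx; exists i.
have coneV s (v : 'rV_n) : V (v 0) -> V ((s *: v) 0).
  by move=> Vv i; rewrite (meval_homog s v (hp i)) Vv mulr0.
apply: contrapT => /eqP tkl0.
(* The subspace is chosen so that [t k l] does not vanish identically on it; it then suffices to
   show that its restriction [phi (t k l)] is 0. *)
have [U [UV [a /eqP]]] := codim_ge_transversal clV codimV coneV (isT : (0 < 3)%N) tkl0.
rewrite -meval_linear_forms; apply.
pose phi (f : {mpoly F[n]}) := f \mPo linear_forms U.
have phi_homog e f : f \is e.-homog -> phi f \is e.-homog.
  apply: comp_mpoly_homog => i; rewrite tnth_mktuple; apply: rpred_sum => j _.
  exact/rpredZ/homog_Xi.
pose J : set {mpoly F[3]} := [set f | exists c, f = \sum_i c i * phi (p i)]%classic.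
have idJ : homog_mideal J.
  split; first split.
  - by exists (fun=> 0); rewrite big1 // => i _; rewrite mul0r.
  - move=> _ _ [c ->] [c' ->]; exists (fun i => c i + c' i).
    by rewrite -big_split; apply: eq_bigr => i _; rewrite mulrDl.
  - move=> f _ [c ->]; exists (fun i => f * c i).
    by rewrite mulr_sumr; apply: eq_bigr => i _; rewrite mulrA.
  - move=> e _ [c ->]; rewrite raddf_sum /=.
    exists (fun i => if (d < e)%N then pihomog mdeg (e - d.+1) (c i) else 0).
    apply: eq_bigr => i _; rewrite (pihomogM_homog _ _ (phi_homog _ _ (hp i))).
    by case: ifP => // _; rewrite mul0r.
have [|N powJ] := homog_nullstellensatz idJ.
  move=> v Jv; pose w := \row_i v i.
  have vE : w 0 =1 v by move=> i; rewrite mxE.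
  have /UV/rowP w0 : V ((w *m U) 0).
    move=> i; rewrite -meval_linear_forms (meval_eq _ vE); apply: Jv.
    exists (fun j => (j == i)%:R); rewrite (bigD1 i) //= eqxx mul1r big1 ?addr0 //.
    by move=> j /negPf ->; rewrite mul0r.
  by move=> i; rewrite -vE w0 mxE.
(* The cofactors serve as contracting vectors: the three contractions of [p] are the [N]-th powers
   of the coordinates. *)
have [a0 xE] := powJ 0; have [b yE] := powJ 1; have [c zE] := powJ (inord 2).
have [|||| r tr] := @koszul2_exact _ n (fun i => phi (p i)) a0 b c
    (fun i j => phi (t i j)).
- by rewrite -xE expf_neq0 // -mleadc_eq0 mleadXm mcoeffX eqxx oner_eq0.
- by rewrite -xE -yE => f g; apply: regular_powers2.
- rewrite -xE -yE -zE => f u v; apply: regular_powers3.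
    by rewrite -val_eqE /= inordK.
  by rewrite -val_eqE /= inordK.
- move=> i j m; rewrite -(comp_mpoly0 (linear_forms U)) -(pt i j m).
  by rewrite /phi rmorphD rmorphB !rmorphM.
rewrite -/(phi _) -(pihomog_dE (phi_homog _ _ (ht k l))) tr.
rewrite pihomogB ![phi _ * _]mulrC !(pihomogM_homog _ _ (phi_homog _ _ (hp _))).
by rewrite ltnn subrr meval0.
Qed.

(** * Differential forms in coordinates *)

Section Forms.

Context (C : comNzRingType) (n : nat).
Implicit Types (f : {mpoly C[n]}) (G H : 'I_n -> {mpoly C[n]}) (A B S : {set 'I_n}).

Lemma wedge_inv1 (i : 'I_n) B : wedge_inv [set i] B = (\sum_(b in B) (b < i))%N.
Proof.
rewrite /wedge_inv (_ : [set p | _] = setX [set i] [set b in B | (b < i)%N]).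
  rewrite cardsX cards1 mul1n -sum1dep_card big_mkcondr.
  by apply: eq_bigr => b _; case: (b < i)%N.
by apply/setP => -[a b]; rewrite !inE /=; case: eqP => // ->.
Qed.

Lemma wedge_inv_set0 A : wedge_inv A set0 = 0%N.
Proof. by apply: eq_card0 => p; rewrite !inE andbF. Qed.

Lemma oneform1 H i : oneform H [set i] = H i.
Proof.
rewrite ffunE (big_pred1 i) // => j.
by rewrite eq_sym; apply/eqP/eqP => [/set1_inj|->].
Qed.

Lemma wedge_oneform H (b : dform C n) S :
  wedge (oneform H) b S =
  \sum_(i in S) (-1) ^+ wedge_inv [set i] (S :\ i) * (H i * b (S :\ i)).
Proof.
rewrite ffunE; under eq_bigr do rewrite ffunE mulr_suml mulr_sumr.
rewrite (exchange_big_dep xpredT) //= [RHS]big_mkcond; apply: eq_bigr => i _.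
case: ifP => Si.
  rewrite (big_pred1 [set i]) // => A /=; case: eqP => [->|]; last by rewrite andbF.
  by rewrite sub1set Si.
by rewrite big_pred0 // => A; case: eqP => [->|]; rewrite ?andbF // sub1set Si.
Qed.

Lemma extd_zeroform f : extd (zeroform f) = oneform (fun i => f^`M(i)).
Proof.
apply/ffunP => S; rewrite !ffunE [LHS]big_mkcond [RHS]big_mkcond.
apply: eq_bigr => i _; rewrite ffunE.
have [->|neS] := eqVneq S [set i].
  by rewrite set11 setDv eqxx wedge_inv_set0 mul1r.
case: ifP => // Si; case: eqP => [Si0|]; last by rewrite mderiv0 mulr0.
by case/eqP: neS; rewrite -(setD1K Si) Si0 setU0.
Qed.

Lemma extd_oneform2 H (j k : 'I_n) : (j < k)%N ->
  extd (oneform H) [set j; k] = (H k)^`M(j) - (H j)^`M(k).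
Proof.
move=> ltjk; have nejk : j != k by rewrite -val_eqE ltn_eqF.
have Dj : [set j; k] :\ j = [set k] by rewrite setU1K // inE.
have Dk : [set j; k] :\ k = [set j] by rewrite setUC setU1K // inE eq_sym.
rewrite ffunE big_setU1 ?inE //= big_set1 Dj Dk !oneform1 !wedge_inv1 !big_set1.
by rewrite ltjk ltnNge ltnW // expr0 expr1 mul1r mulN1r.
Qed.

Lemma wedge_oneform_extd3 G H (j k l : 'I_n) : (j < k)%N -> (k < l)%N ->
  wedge (oneform G) (extd (oneform H)) [set j; k; l] =
  G j * ((H l)^`M(k) - (H k)^`M(l)) - G k * ((H l)^`M(j) - (H j)^`M(l))
    + G l * ((H k)^`M(j) - (H j)^`M(k)).
Proof.
move=> ltjk ltkl; have ltjl := ltn_trans ltjk ltkl.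
have nejk : j != k by rewrite -val_eqE ltn_eqF.
have nekl : k != l by rewrite -val_eqE ltn_eqF.
have nejl : j != l by rewrite -val_eqE ltn_eqF.
have Dl : [set j; k; l] :\ l = [set j; k].
  by rewrite setUC setU1K // !inE negb_or ![l == _]eq_sym nejl.
have Dj : [set j; k; l] :\ j = [set k; l].
  by rewrite -setUA setU1K // !inE negb_or nejk.
have Dk : [set j; k; l] :\ k = [set j; l].
  by rewrite (setUC [set j]) -setUA setU1K // !inE negb_or eq_sym nejk.
rewrite wedge_oneform (big_setD1 j) ?inE ?eqxx //= Dj big_setU1 ?inE //= big_set1.
rewrite Dk Dl !extd_oneform2 // !wedge_inv1 !big_setU1 ?inE //= !big_set1.
rewrite ltjk ltjl ltkl (leq_gtF (ltnW ltjk)) (leq_gtF (ltnW ltjl)).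
rewrite (leq_gtF (ltnW ltkl)) !addn0 expr0 expr1 expr2.
ring.
Qed.

Lemma dformD (a b : dform C n) S : (a + b) S = a S + b S.
Proof. exact: ffunE. Qed.

Lemma dform0 S : (0 : dform C n) S = 0.
Proof. exact: ffunE. Qed.

End Forms.

(** * Exactness of first order deformations *)

Lemma first_order_deformation_exact (F : numClosedFieldType) (n e : nat)
    (P : {mpoly F[n]}) (eta : dform F n) :
    P \is e.-homog -> codim_ge 3 (singular_locus (extd (zeroform P))) ->
    first_order_deformation e (extd (zeroform P)) eta ->
  exists Q : {mpoly F[n]}, Q \is e.-homog /\
    (extd (zeroform P), eta) = eps_extd (zeroform P, zeroform Q).
Proof.
move=> hP hcodim heta.
have [[H [-> hH]]] := heta; rewrite extd_zeroform => -[_ dPdH].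
suff [Q hQ HQ] : exists2 Q : {mpoly F[n]}, Q \is e.-homog & forall i, Q^`M(i) = H i.
  exists Q; split=> //; rewrite /eps_extd /= !extd_zeroform; congr pair.
  by congr oneform; apply/funext => i; rewrite HQ.
(* In degree 0 the form is 0 by convention, and [Q = 0] works. *)
case: e => [|d] in hP hH heta *.
  by exists 0; [exact: rpred0 | move=> i; rewrite hH mderiv0].
pose T j k := (H k)^`M(j) - (H j)^`M(k).
have relT j k l : P^`M(j) * T k l - P^`M(k) * T j l + P^`M(l) * T j k = 0.
  (* On increasing indices this is a coefficient of the deformation equation; the other summand
     contains [d (dP)], which is 0 by symmetry of second derivatives. *)
  have sorted (a b c : 'I_n) : (a < b)%N -> (b < c)%N ->
      P^`M(a) * T b c - P^`M(b) * T a c + P^`M(c) * T a b = 0.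
    move=> ltab ltbc; have := congr1 (fun w : dform _ _ => w [set a; b; c]) dPdH.
    rewrite dformD dform0 !wedge_oneform_extd3 //.
    have dd u v : (P^`M(u))^`M(v) - (P^`M(v))^`M(u) = 0.
      by rewrite mderiv_comm subrr.
    by rewrite !dd !mulr0 subr0 !addr0.
  have Tanti a b : T a b = - T b a by rewrite /T opprB.
  have Taa a : T a a = 0 by rewrite /T subrr.
  (* The left side is alternating in the indices, so all cases follow from the sorted one. *)
  case: (ltngtP j k) => [ltjk|ltkj|/val_inj <-]; last first.
  - by rewrite Taa mulr0 addr0 subrr.
  - case: (ltngtP j l) => [ltjl|ltlj|/val_inj <-]; last first.
    + by rewrite (Tanti k j) Taa; ring.
    + case: (ltngtP k l) => [ltkl|ltlk|/val_inj <-]; last first.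
      * by rewrite Taa; ring.
      * rewrite -[RHS]oppr0 -(sorted l k j ltlk ltkj).
        by rewrite (Tanti k l) (Tanti j l) (Tanti j k); ring.
      * rewrite -(sorted k l j ltkl ltlj).
        by rewrite (Tanti j l) (Tanti j k); ring.
    + rewrite -[RHS]oppr0 -(sorted k j l ltkj ltjl).
      by rewrite (Tanti j k); ring.
  - case: (ltngtP k l) => [ltkl|ltlk|/val_inj <-]; last first.
    + by rewrite Taa; ring.
    + case: (ltngtP j l) => [ltjl|ltlj|/val_inj <-]; last first.
      * by rewrite (Tanti k j) Taa; ring.
      * by rewrite -(sorted l j k ltlj ltjk) (Tanti k l) (Tanti j l); ring.
      * rewrite -[RHS]oppr0 -(sorted j l k ltjl ltlk).
        by rewrite (Tanti k l); ring.
    + exact: sorted.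
have T0 j k : T j k = 0.
  (* In degree 1 the [H i] are constants; from degree 2 on, [T] has degree one less than the
     derivatives of [P]. *)
  case: d hP hH {heta} => [|d] hP hH.
    have d0 i m : (H i)^`M(m) = 0.
      apply/mpolyP => u; rewrite mcoeff_mderiv mcoeff0 memN_msupp_eq0 ?mul0rn //.
      apply/negP => /(dhomogP _ _ _ (hH i)) /= /eqP.
      by rewrite mdegD mdeg1 addn1.
    by rewrite /T !d0 subrr.
  apply: (low_degree_koszul2_eq0 (p := fun i => P^`M(i)) (d := d)) => //.
  - by move=> i; have := mderiv_homog i hP.
  - by move=> a b; rewrite rpredB //; apply: mderiv_homog (hH _).
  - move: hcodim; congr (codim_ge 3 _); apply/seteqP.
    by rewrite extd_zeroform; split=> x Vx i; have := Vx i; rewrite oneform1.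
have d0 : d.+1%:R != 0 :> F by rewrite Num.Theory.pnatr_eq0.
exists (d.+1%:R^-1 *: \sum_j 'X_j * H j).
  apply/rpredZ/rpred_sum => j _; rewrite -add1n.
  by apply: dhomogM (hH j); apply: homog_Xi.
move=> i; rewrite mderivZ (raddf_sum (mderiv i)) /=.
(* Since [T] vanishes, the derivative of ['X_j * H j] along [i] can be written with the derivative
   of [H i] along [j]; Euler's formula for [H i] then gives [d.+1] times [H i]. *)
rewrite (eq_bigr (fun j => (if j == i then H j else 0) + 'X_j * (H i)^`M(j))); last first.
  move=> j _; have -> : (H i)^`M(j) = (H j)^`M(i) := subr0_eq (T0 j i).
  rewrite mderivM mderivX mnm1E; case: eqP => [->|_]; last by rewrite scale0r mul0r.
  by rewrite scale1r -{1}[U_(i)%MM]add0m addmK mpolyX0 mul1r.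
rewrite big_split /= -big_mkcond big_pred1_eq (euler_homog (hH i)) -mulrS.
by rewrite -scaler_nat scalerA mulVf // scale1r.
Qed.

Theorem theorem1p3 (R : realType) (n e : nat) (hn : (3 <= n)%N)
    (P : {mpoly R[i][n]}) (hP : P \is e.-homog)
    (hcodim : codim_ge 3 (singular_locus (extd (zeroform P))))
    (eta : dform R[i] n)
    (heta : first_order_deformation e (extd (zeroform P)) eta) :
  exists Q : {mpoly R[i][n]}, Q \is e.-homog /\
    (extd (zeroform P), eta) = eps_extd (zeroform P, zeroform Q).
Proof. exact: first_order_deformation_exact hP hcodim heta. Qed.
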